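(* Let $U$ be a utility function of wealth that is twice continuously differentiable with positive first derivative, and let $h:[0,1]\to[0,1]$ be twice continuously differentiable with $h(0)=0$, $h(1)=1$ and $h'(p)>0$. Let $w_0$ be the initial wealth level, $0<p_0<1$, $0<\varepsilon_1<\min\{p_0,1-p_0\}$ and $\varepsilon_2>0$. Let $\lambda$ be the rank-dependent utility (RDU) risk premium, i.e. the solution of $$h(p_0)U(w_0-\varepsilon_2)+(1-h(p_0))U(w_0+\varepsilon_2)=h(p_0-\varepsilon_1)U(w_0-\varepsilon_2)+\big(h(p_0+\varepsilon_1)-h(p_0-\varepsilon_1)\big)U(w_0-\lambda)+(1-h(p_0+\varepsilon_1))U(w_0+\varepsilon_2).$$ Then, approximating the solution of this equation by Taylor series expansions, up to the first order in $\lambda$ around $U(w_0)$ and up to the second orders in $\varepsilon_1$ and $\varepsilon_2$ around $h(p_0)$ and $U(w_0)$, one obtains the following approximation for the RDU risk premium: $$\lambda\simeq\frac{m_2}{2\,\mathrm{Pr}}\left(-\frac{U''(w_0)}{U'(w_0)}\right)+\frac{\bar{m}_2}{2\,\mathrm{Pr}}\left(-\frac{h''(p_0)}{h'(p_0)}\right),$$ where $m_2=2\varepsilon_1\varepsilon_2^2$, $\bar{m}_2=2\varepsilon_1^2\varepsilon_2$ and $\mathrm{Pr}=2\varepsilon_1$ are the unconditional variance, the unconditional maxiance and the total unconditional probability mass of the risk that, unconditionally, takes the values $\pm\varepsilon_2$ each with probability $\varepsilon_1$.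
   Context: Under RDU, a lottery with cumulative distribution function $F$ is evaluated by $\int U(x)\,\mathrm{d}h(F(x))$, where $h$ is the probability weighting function. The equation for $\lambda$ expresses indifference between lottery $C$ (final wealth $w_0-\varepsilon_2$ with probability $p_0$, $w_0+\varepsilon_2$ with probability $1-p_0$) and lottery $D$ (final wealth $w_0-\varepsilon_2$ with probability $p_0-\varepsilon_1$, $w_0+y$ with probability $2\varepsilon_1$, $w_0+\varepsilon_2$ with probability $1-p_0-\varepsilon_1$), where $-\varepsilon_2<y<\varepsilon_2$ and $\lambda=0-y$. With $y=0$, lottery $C$ is a mean-preserving spread of $D$, obtained by attaching the zero-mean risk with values $\pm\varepsilon_2$ to the intermediate state of $D$. The maxiance (second dual moment about the mean) of a risk $X$ with distribution function $F$ and mean $m$ is $\mathbb{E}[\max(X^{(1)},X^{(2)})]-\mathbb{E}[X]=\int(x-m)\,\mathrm{d}(F(x))^2$, with $X^{(1)},X^{(2)}$ independent copies of $X$; ''unconditional'' means computed with the unconditional probabilities $\varepsilon_1,\varepsilon_1$ of the two values. Both the variance and the maxiance are considered to be small. The symbol $\simeq$ denotes the approximation resulting from the stated Taylor expansions; no error term is asserted. *)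

(* Defs.v *)
From Stdlib Require Import Reals Lra List.
Import ListNotations.
Open Scope R_scope.

Definition interval_set (I : R -> Prop) : Prop :=
  forall x y z : R, I x -> I y -> x <= z <= y -> I z.

Definition unit_interval (p : R) : Prop := 0 <= p <= 1.

(* [f] is twice continuously differentiable on [I] with first and second
   derivatives [f'] and [f''].  Limits are taken inside [I], so derivatives are
   one-sided at an endpoint belonging to [I]. *)
Definition C2_on (I : R -> Prop) (f f' f'' : R -> R) : Prop :=
  forall x : R, I x ->
    D_in f f' I x /\ D_in f' f'' I x /\ continue_in f'' I x.

(* Taylor polynomials of [f] around [a], evaluated at the increment [t]. *)
Definition taylor1 (f f' : R -> R) (a t : R) : R := f a + f' a * t.

Definition taylor2 (f f' f'' : R -> R) (a t : R) : R :=
  f a + f' a * t + f'' a / 2 * t ^ 2.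

(* Indifference of lotteries C and D.  The transformed cumulative probabilities
   [hm], [h0], [hp] stand for h(p0 - e1), h(p0), h(p0 + e1), and the utilities
   [um], [ul], [up] for U(w0 - e2), U(w0 - l), U(w0 + e2); they are arguments
   so that each can be replaced by its Taylor polynomial. *)
Definition rdu_indifference (hm h0 hp um ul up : R) : Prop :=
  h0 * um + (1 - h0) * up = hm * um + (hp - hm) * ul + (1 - hp) * up.

Definition rdu_premium_equation (U h : R -> R) (w0 p0 e1 e2 l : R) : Prop :=
  rdu_indifference (h (p0 - e1)) (h p0) (h (p0 + e1))
                   (U (w0 - e2)) (U (w0 - l)) (U (w0 + e2)).

(* The terms of order e1^2 e2^2 arising when the polynomials are multiplied out
   cancel, so truncating the products makes no difference. *)
Definition expanded_premium_equation
    (U U' U'' h h' h'' : R -> R) (w0 p0 e1 e2 l : R) : Prop :=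
  rdu_indifference
    (taylor2 h h' h'' p0 (- e1)) (h p0) (taylor2 h h' h'' p0 e1)
    (taylor2 U U' U'' w0 (- e2)) (taylor1 U U' w0 (- l))
    (taylor2 U U' U'' w0 e2).

(* A finitely supported risk: pairs (value, unconditional probability).  The
   probabilities need not sum to one, and the moments below are computed with
   them as they stand, without conditioning on the support. *)
Definition risk : Type := list (R * R).

Definition expect (g : R -> R) (X : risk) : R :=
  fold_right Rplus 0 (map (fun a => snd a * g (fst a)) X).

Definition mass (X : risk) : R := expect (fun _ => 1) X.

Definition mean (X : risk) : R := expect (fun x => x) X.

Definition variance (X : risk) : R := expect (fun x => (x - mean X) ^ 2) X.

(* E[max(X1, X2)] - E[X], for independent copies X1, X2 of X. *)
Definition maxiance (X : risk) : R :=
  expect (fun x1 => expect (fun x2 => Rmax x1 x2) X) X - mean X.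

(* The values -e2 and e2, each with unconditional probability e1. *)
Definition symmetric_risk (e1 e2 : R) : risk := [(- e2, e1); (e2, e1)].

Definition rdu_premium_approx
    (U' U'' h' h'' : R -> R) (w0 p0 m2 mbar2 Pr : R) : R :=
  m2 / (2 * Pr) * - (U'' w0 / U' w0) + mbar2 / (2 * Pr) * - (h'' p0 / h' p0).

(* Main.v *)
(** The indifference equation says that U(w0 - l) is the average of
    U(w0 - e2) and U(w0 + e2) with weights D- = h(p0) - h(p0 - e1) and
    D+ = h(p0 + e1) - h(p0).  Hence |l| <= e2 by monotonicity, and
    U(w0 - l) - U(w0) equals, up to o(e2^2 + e1 e2), U''(w0)/2 e2^2 plus
    U'(w0) e2 (D+ - D-)/(D+ + D-), where the quotient is
    h''(p0)/(2 h'(p0)) e1 + o(e1).  A first-order expansion of U at w0 then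
    gives l.  The second-order expansions come from the mean value theorem
    applied to the Taylor remainder. *)
Require Import Defs.
From Stdlib Require Import Reals Lra List.
From Coquelicot Require Import Coquelicot.
Open Scope R_scope.

(** * Mean value theorem and monotonicity on an interval with relative derivatives *)

Definition clamp (a b x : R) : R := Rmax a (Rmin b x).

Lemma clamp_bounds (a b x : R) : a <= b -> a <= clamp a b x <= b.
Proof.
  intros Hab. unfold clamp, Rmax, Rmin.
  destruct (Rle_dec b x); destruct (Rle_dec _ _); lra.
Qed.

Lemma clamp_id (a b x : R) : a <= x <= b -> clamp a b x = x.
Proof.
  intros Hx. unfold clamp, Rmax, Rmin.
  destruct (Rle_dec b x); destruct (Rle_dec _ _); lra.
Qed.

(** Lets continuity relative to [[a, b]] pass to two-sided continuity after clamping. *)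
Lemma clamp_lipschitz (a b x y : R) :
  Rabs (clamp a b y - clamp a b x) <= Rabs (y - x).
Proof.
  unfold clamp, Rmax, Rmin.
  destruct (Rle_dec b x); destruct (Rle_dec b y);
    repeat destruct (Rle_dec a _); unfold Rabs;
    repeat destruct Rcase_abs; lra.
Qed.

Lemma D_in_expansion (I : R -> Prop) (f f' : R -> R) (a : R) :
  D_in f f' I a ->
  forall eta, 0 < eta -> exists delta, 0 < delta /\
    forall x, I x -> Rabs (x - a) < delta ->
      Rabs (f x - taylor1 f f' a (x - a)) <= eta * Rabs (x - a).
Proof.
  intros HD eta Heta.
  destruct (HD eta Heta) as [delta [Hdelta Hlim]].
  exists delta; split; [exact Hdelta|].
  intros x Ix Hx.
  destruct (Req_dec a x) as [<-|Hne].
  { unfold taylor1. replace (f a - (f a + f' a * (a - a))) with 0 by ring.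
    replace (a - a) with 0 by ring. rewrite Rabs_R0. lra. }
  specialize (Hlim x (conj (conj Ix Hne) Hx)).
  simpl in Hlim. unfold Rdist in Hlim.
  unfold taylor1.
  replace (f x - (f a + f' a * (x - a)))
    with (((f x - f a) / (x - a) - f' a) * (x - a)) by (field; lra).
  rewrite Rabs_mult.
  apply Rmult_le_compat_r; [apply Rabs_pos|lra].
Qed.

(* [f] is composed with [clamp] because at an endpoint of [I] it is only
   continuous relatively to [I]. *)
Lemma MVT_on (I : R -> Prop) (f f' : R -> R) (a b : R) :
  interval_set I -> (forall x, I x -> D_in f f' I x) ->
  I a -> I b -> a < b ->
  exists c, a <= c <= b /\ f b - f a = f' c * (b - a).
Proof.
  intros HI HD Ia Ib Hab.
  assert (Hin : forall x, a <= x <= b -> I x) by (intros x Hx; exact (HI a b x Ia Ib Hx)).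
  destruct (MVT_gen (fun x => f (clamp a b x)) a b f') as [c [Hc Heq]].
  - rewrite Rmin_left, Rmax_right by lra.
    intros x Hx. apply is_derive_Reals.
    intros eps Heps.
    destruct (HD x (Hin x ltac:(lra)) eps Heps) as [d [Hd Hlim]].
    (* The radius keeps [x + t] inside [[a, b]], where clamping is the identity. *)
    assert (Hpos : 0 < Rmin d (Rmin (x - a) (b - x))).
    { repeat apply Rmin_glb_lt; lra. }
    exists (mkposreal _ Hpos); simpl.
    intros t Ht Htd.
    apply Rmin_Rgt_l in Htd as [Ht1 Ht2].
    apply Rmin_Rgt_l in Ht2 as [Ht2 Ht3].
    assert (Hxt : a <= x + t <= b).
    { revert Ht2 Ht3. unfold Rabs. destruct Rcase_abs; lra. }
    rewrite (clamp_id a b (x + t)) by lra.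
    rewrite (clamp_id a b x) by lra.
    assert (Hlt := Hlim (x + t)).
    simpl in Hlt. unfold Rdist in Hlt.
    replace (x + t - x) with t in Hlt by ring.
    apply Hlt. repeat split; [apply Hin; lra|lra|lra].
  - rewrite Rmin_left, Rmax_right by lra.
    intros x _ eps Heps.
    assert (Hcl := clamp_bounds a b x ltac:(lra)).
    destruct (cont_deriv _ _ _ _ (HD _ (Hin _ Hcl)) eps Heps) as [d [Hd Hlim]].
    exists d; split; [exact Hd|].
    intros y [_ Hy].
    (* Distinct points may be clamped to the same point, and relative continuity speaks only of
       points other than the centre. *)
    destruct (Req_dec (clamp a b x) (clamp a b y)) as [E|Hne].
    + rewrite E. simpl. rewrite Rdist_eq. exact Heps.
    + apply Hlim. repeat split; [|exact Hne|].
      * apply Hin, clamp_bounds; lra.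
      * eapply Rle_lt_trans; [apply clamp_lipschitz|exact Hy].
  - rewrite Rmin_left, Rmax_right in Hc by lra.
    rewrite !clamp_id in Heq by lra.
    exists c; split; assumption.
Qed.

Lemma increasing_on (I : R -> Prop) (f f' : R -> R) :
  interval_set I -> (forall x, I x -> D_in f f' I x) ->
  (forall x, I x -> 0 < f' x) ->
  forall a b, I a -> I b -> a < b -> f a < f b.
Proof.
  intros HI HD Hpos a b Ia Ib Hab.
  destruct (MVT_on I f f' a b HI HD Ia Ib Hab) as [c [Hc Heq]].
  assert (0 < f' c) by (apply Hpos, (HI a b); assumption).
  assert (0 < f' c * (b - a)) by (apply Rmult_lt_0_compat; lra).
  lra.
Qed.

(** * Second-order Taylor expansion *)

Lemma D_in_taylor2_remainder (I : R -> Prop) (f f' f'' : R -> R) (a x : R) :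
  D_in f f' I x ->
  D_in (fun y => f y - taylor2 f f' f'' a (y - a))
       (fun y => f' y - taylor1 f' f'' a (y - a)) I x.
Proof.
  intros HD.
  apply (Dminus I f' (fun y => taylor1 f' f'' a (y - a))
                f (fun y => taylor2 f f' f'' a (y - a)) x HD).
  apply (D_in_imp _ _ no_cond); [intros; exact Logic.I|].
  apply derivable_pt_lim_D_in, is_derive_Reals.
  unfold taylor1, taylor2. auto_derive; [exact Logic.I|field].
Qed.

(** The remainder [g] vanishes at [a], so [g x = g' c * (x - a)] with [c] between [a] and [x]. Here
    [g'] is the first-order remainder of [f'], so [g' c] is at most [eta * Rabs (c - a)] in absolute
    value. *)
Lemma taylor2_expansion (I : R -> Prop) (f f' f'' : R -> R) (a : R) :
  interval_set I -> C2_on I f f' f'' -> I a ->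
  forall eta, 0 < eta -> exists delta, 0 < delta /\
    forall x, I x -> Rabs (x - a) < delta ->
      Rabs (f x - taylor2 f f' f'' a (x - a)) <= eta * (x - a) ^ 2.
Proof.
  intros HI HC Ia eta Heta.
  destruct (D_in_expansion I f' f'' a (proj1 (proj2 (HC a Ia))) eta Heta)
    as [delta [Hdelta Hexp]].
  exists delta; split; [exact Hdelta|].
  intros x Ix Hx.
  pose (g := fun y => f y - taylor2 f f' f'' a (y - a)).
  pose (g' := fun y => f' y - taylor1 f' f'' a (y - a)).
  assert (Hg : forall y, I y -> D_in g g' I y)
    by (intros y Iy; apply D_in_taylor2_remainder, HC, Iy).
  assert (Hga : g a = 0).
  { unfold g, taylor2. replace (a - a) with 0 by ring. ring. }
  assert (Hc : exists c, Rabs (c - a) <= Rabs (x - a) /\ I c /\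
                 g x = g' c * (x - a)).
  { destruct (Rtotal_order a x) as [Hax|[E|Hax]].
    - destruct (MVT_on I g g' a x HI Hg Ia Ix Hax) as [c [Hc Heq]].
      exists c; repeat split; [|exact (HI a x c Ia Ix Hc)|lra].
      rewrite !Rabs_right; lra.
    - exists a. subst x. rewrite Hga. repeat split; [lra|assumption|ring].
    - destruct (MVT_on I g g' x a HI Hg Ix Ia Hax) as [c [Hc Heq]].
      exists c; repeat split; [|exact (HI x a c Ix Ia Hc)|lra].
      rewrite !Rabs_left1; lra. }
  destruct Hc as [c [Hca [Ic Heq]]].
  fold (g x). rewrite Heq, Rabs_mult.
  rewrite <- Rsqr_pow2, (Rsqr_abs (x - a)). unfold Rsqr. rewrite <- Rmult_assoc.
  apply Rmult_le_compat_r; [apply Rabs_pos|].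
  apply Rle_trans with (eta * Rabs (c - a)).
  - apply Hexp; [exact Ic|lra].
  - apply Rmult_le_compat_l; lra.
Qed.

(** * Moments of the symmetric risk and the root of the expanded equation *)

(** The mean is zero by symmetry. Of the four ordered pairs of values, three have maximum [e2] and
    one has maximum [- e2], whence the factor 2 in the maxiance. *)
Lemma symmetric_risk_moments (e1 e2 : R) :
  0 < e2 ->
  variance (symmetric_risk e1 e2) = 2 * e1 * e2 ^ 2 /\
  maxiance (symmetric_risk e1 e2) = 2 * e1 ^ 2 * e2 /\
  mass (symmetric_risk e1 e2) = 2 * e1.
Proof.
  intros He2.
  unfold variance, maxiance, mass, mean, expect, symmetric_risk; simpl.
  rewrite (Rmax_left (- e2) (- e2)), (Rmax_right (- e2) e2),
    (Rmax_left e2 (- e2)), (Rmax_left e2 e2) by lra.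
  repeat split; ring.
Qed.

Lemma rdu_premium_approx_symmetric
    (U' U'' h' h'' : R -> R) (w0 p0 e1 e2 : R) :
  0 < e1 ->
  rdu_premium_approx U' U'' h' h'' w0 p0
    (2 * e1 * e2 ^ 2) (2 * e1 ^ 2 * e2) (2 * e1) =
  - (U'' w0 / U' w0) / 2 * e2 ^ 2 - h'' p0 / h' p0 / 2 * (e1 * e2).
Proof.
  intros He1. unfold rdu_premium_approx, Rdiv.
  (* The two ratios are made opaque so that [field] asks only for [e1] to be nonzero. *)
  set (x := U'' w0 * / U' w0). set (y := h'' p0 * / h' p0).
  field. lra.
Qed.

(** The difference of the two sides is affine in [l] with positive slope [2 * e1 * h' p0 * U' w0],
    so it has exactly one root. *)
Lemma expanded_premium_equation_solution
    (U U' U'' h h' h'' : R -> R) (w0 p0 e1 e2 l : R) :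
  0 < U' w0 -> 0 < h' p0 -> 0 < e1 ->
  expanded_premium_equation U U' U'' h h' h'' w0 p0 e1 e2 l <->
  l = - (U'' w0 / U' w0) / 2 * e2 ^ 2 - h'' p0 / h' p0 / 2 * (e1 * e2).
Proof.
  intros HU Hh He1.
  set (s := - (U'' w0 / U' w0) / 2 * e2 ^ 2 - h'' p0 / h' p0 / 2 * (e1 * e2)).
  unfold expanded_premium_equation, rdu_indifference, taylor1, taylor2.
  match goal with |- ?L = ?R <-> _ =>
    assert (Hdiff : L - R = 2 * e1 * h' p0 * U' w0 * (l - s))
      by (unfold s; field; lra) end.
  assert (Hk : 0 < 2 * e1 * h' p0 * U' w0)
    by (repeat apply Rmult_lt_0_compat; lra).
  split; intros H.
  - apply Rminus_diag_eq in H. rewrite H in Hdiff.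
    symmetry in Hdiff. apply Rmult_integral in Hdiff. lra.
  - apply Rminus_diag_uniq. rewrite Hdiff, H. ring.
Qed.

(** * The exact indifference equation and its error estimates *)

Lemma rdu_indifference_weighted (hm h0 hp um ul up : R) :
  rdu_indifference hm h0 hp um ul up ->
  (h0 - hm) * (ul - um) = (hp - h0) * (up - ul).
Proof. unfold rdu_indifference. intros H. lra. Qed.

(** If [w0 - l] lay outside the interval from [w0 - e2] to [w0 + e2], the two sides of the weighted
    equation would have opposite strict signs. The bound brings [l] into the range of the
    first-order expansion once [e2] is small. *)
Lemma rdu_premium_le (I : R -> Prop) (U h : R -> R) (w0 p0 e1 e2 l : R) :
  (forall a b, I a -> I b -> a < b -> U a < U b) ->
  h (p0 - e1) < h p0 < h (p0 + e1) ->
  0 < e2 -> I (w0 - e2) -> I (w0 + e2) -> I (w0 - l) ->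
  rdu_premium_equation U h w0 p0 e1 e2 l ->
  Rabs l <= e2.
Proof.
  intros HU Hh He2 Im Ip Il Heq.
  apply rdu_indifference_weighted in Heq.
  assert (Hmp := HU _ _ Im Ip ltac:(lra)).
  apply Rabs_le; split; apply Rnot_lt_le; intros Hl.
  - assert (H := HU _ _ Ip Il ltac:(lra)).
    assert (0 < (h p0 - h (p0 - e1)) * (U (w0 - l) - U (w0 - e2)))
      by (apply Rmult_lt_0_compat; lra).
    assert (0 < (h (p0 + e1) - h p0) * (U (w0 - l) - U (w0 + e2)))
      by (apply Rmult_lt_0_compat; lra).
    lra.
  - assert (H := HU _ _ Il Im ltac:(lra)).
    assert (0 < (h p0 - h (p0 - e1)) * (U (w0 - e2) - U (w0 - l)))
      by (apply Rmult_lt_0_compat; lra).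
    assert (0 < (h (p0 + e1) - h p0) * (U (w0 + e2) - U (w0 - l)))
      by (apply Rmult_lt_0_compat; lra).
    lra.
Qed.

(* [dm], [dp] are the decision weights D-, D+; [vm], [vp], [vl] are the
   utility increments U(w0 - e2) - U(w0), U(w0 + e2) - U(w0) and
   U(w0 - l) - U(w0). *)
Lemma weighted_increment_bound
    (A B P Q k e1 e2 dm dp vm vp vl : R) :
  0 < A -> 0 < P -> 0 < k <= 1 -> 0 < e1 -> e1 <= 1 -> 2 * e1 <= P -> 0 < e2 ->
  0 < dm -> 0 < dp ->
  Rabs (dm - (P * e1 - Q / 2 * e1 ^ 2)) <= k * e1 ^ 2 ->
  Rabs (dp - (P * e1 + Q / 2 * e1 ^ 2)) <= k * e1 ^ 2 ->
  Rabs (vm - (- A * e2 + B / 2 * e2 ^ 2)) <= k * e2 ^ 2 ->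
  Rabs (vp - (A * e2 + B / 2 * e2 ^ 2)) <= k * e2 ^ 2 ->
  dm * (vl - vm) = dp * (vp - vl) ->
  Rabs (vl - (B / 2 * e2 ^ 2 + A * (Q / P / 2) * (e1 * e2))) <=
    k * (e2 ^ 2 + 2 * A * (1 + Rabs (Q / P / 2)) / P * (e1 * e2)).
Proof.
  intros HA HP Hk He1 He1' He1P He2 Hdm Hdp Hm Hp Hvm Hvp Heq.
  set (q := Q / P / 2).
  (* Eliminating [Q] in favour of [q] makes the identity [Hid] below free of division by [P]. *)
  assert (HQ : Q = 2 * P * q) by (unfold q; field; lra).
  rewrite HQ in Hm, Hp. clear HQ.
  set (rm := vm - (- A * e2 + B / 2 * e2 ^ 2)) in *.
  set (rp := vp - (A * e2 + B / 2 * e2 ^ 2)) in *.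
  set (sm := dm - (P * e1 - 2 * P * q / 2 * e1 ^ 2)) in *.
  set (sp := dp - (P * e1 + 2 * P * q / 2 * e1 ^ 2)) in *.
  set (S := dm + dp).
  assert (He1sq : 0 <= k * e1 ^ 2) by (apply Rmult_le_pos; [lra|apply pow2_ge_0]).
  (* The leading part of [S] is [2 * P * e1]; since [k <= 1] and [2 * e1 <= P], the remainders
     remove at most half of it. *)
  assert (HSP : P * e1 <= S).
  { assert (E : S = 2 * P * e1 + sm + sp) by (unfold S, sm, sp; field).
    apply Rabs_le_between in Hm. apply Rabs_le_between in Hp.
    assert (k * e1 ^ 2 <= 1 * e1 ^ 2)
      by (apply Rmult_le_compat_r; [apply pow2_ge_0|lra]).
    assert (2 * e1 * e1 <= P * e1) by (apply Rmult_le_compat_r; lra).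
    simpl in *. lra. }
  assert (HPe : 0 < P * e1) by (apply Rmult_lt_0_compat; lra).
  (* By the weighted equation, [S * vl = dm * vm + dp * vp]. All leading terms cancel, leaving only
     the four remainders. *)
  assert (Hid : S * (vl - (B / 2 * e2 ^ 2 + A * q * (e1 * e2))) =
    A * e2 * ((1 - q * e1) * sp - (1 + q * e1) * sm) + (dm * rm + dp * rp)).
  { replace (S * (vl - (B / 2 * e2 ^ 2 + A * q * (e1 * e2))))
      with (dm * vm + dp * vp - S * (B / 2 * e2 ^ 2 + A * q * (e1 * e2)))
      by (unfold S; lra).
    unfold S, sm, sp, rm, rp. field. }
  set (X := vl - (B / 2 * e2 ^ 2 + A * q * (e1 * e2))) in *.
  assert (Hqe : Rabs (q * e1) <= Rabs q).
  { rewrite Rabs_mult, (Rabs_right e1) by lra.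
    rewrite <- (Rmult_1_r (Rabs q)) at 2.
    apply Rmult_le_compat_l; [apply Rabs_pos|lra]. }
  assert (Hfac : Rabs ((1 - q * e1) * sp - (1 + q * e1) * sm)
                 <= 2 * (1 + Rabs q) * (k * e1 ^ 2)).
  { assert (H1 : Rabs ((1 - q * e1) * sp) <= (1 + Rabs q) * (k * e1 ^ 2)).
    { rewrite Rabs_mult. apply Rmult_le_compat; try apply Rabs_pos; [|lra].
      apply Rabs_le_between in Hqe. apply Rabs_le. lra. }
    assert (H2 : Rabs ((1 + q * e1) * sm) <= (1 + Rabs q) * (k * e1 ^ 2)).
    { rewrite Rabs_mult. apply Rmult_le_compat; try apply Rabs_pos; [|lra].
      apply Rabs_le_between in Hqe. apply Rabs_le. lra. }
    apply Rabs_le_between in H1. apply Rabs_le_between in H2.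
    apply Rabs_le. lra. }
  assert (Hrem : Rabs (dm * rm + dp * rp) <= S * (k * e2 ^ 2)).
  { eapply Rle_trans; [apply Rabs_triang|].
    rewrite !Rabs_mult, (Rabs_right dm), (Rabs_right dp) by lra.
    unfold S. rewrite Rmult_plus_distr_r.
    apply Rplus_le_compat; apply Rmult_le_compat_l; lra. }
  assert (HS : 0 < S) by lra.
  apply Rmult_le_reg_l with S; [exact HS|].
  rewrite <- (Rabs_right S) at 1 by lra. rewrite <- Rabs_mult, Hid.
  eapply Rle_trans; [apply Rabs_triang|].
  rewrite Rabs_mult, (Rabs_right (A * e2))
    by (apply Rle_ge, Rmult_le_pos; lra).
  assert (HAe2 : 0 <= A * e2) by (apply Rmult_le_pos; lra).
  apply (Rmult_le_compat_l (A * e2)) in Hfac; [|exact HAe2].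
  (* One factor [e1] goes with [P] to form [P * e1], which [HSP] bounds by [S], so that [S]
     cancels. *)
  assert (Hlead : A * e2 * (2 * (1 + Rabs q) * (k * e1 ^ 2)) =
    P * e1 * (k * (2 * A * (1 + Rabs q) / P * (e1 * e2)))) by (field; lra).
  assert (Hpos : 0 <= k * (2 * A * (1 + Rabs q) / P * (e1 * e2))).
  { assert (Hq := Rabs_pos q).
    assert (0 < / P) by (apply Rinv_0_lt_compat; lra).
    unfold Rdiv. repeat apply Rmult_le_pos; lra. }
  apply (Rmult_le_compat_r _ _ _ Hpos) in HSP.
  lra.
Qed.

(** Comparing the two estimates of [vl] bounds [A * Rabs d] by a multiple of the small terms plus
    [k * Rabs l]. Since [l] is [d] plus the approximation, the latter brings back [k * Rabs d],
    which [k <= A / 2] absorbs into the left side. *)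
Lemma premium_error_bound (A b q k C d e1 e2 l vl : R) :
  0 < A -> 0 < k <= A / 2 -> 0 < e1 -> 0 < e2 -> 0 <= C ->
  Rabs (vl + A * l) <= k * Rabs l ->
  Rabs (vl - (A * b * e2 ^ 2 + A * q * (e1 * e2)))
    <= k * (e2 ^ 2 + C * (e1 * e2)) ->
  d = l - (- b * e2 ^ 2 - q * (e1 * e2)) ->
  Rabs d <= 2 * k / A * (1 + C + Rabs b + Rabs q) * (e2 ^ 2 + e1 * e2).
Proof.
  intros HA Hk He1 He2 HC Hl Hv Hd.
  assert (HE : 0 <= e2 ^ 2) by apply pow2_ge_0.
  assert (HF : 0 <= e1 * e2) by (apply Rmult_le_pos; lra).
  set (E := e2 ^ 2) in *. set (F := e1 * e2) in *.
  assert (HAd : A * Rabs d <= k * Rabs l + k * (E + C * F)).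
  { rewrite <- (Rabs_right A) at 1 by lra. rewrite <- Rabs_mult.
    replace (A * d) with ((vl + A * l) - (vl - (A * b * E + A * q * F)))
      by (rewrite Hd; ring).
    eapply Rle_trans; [apply Rabs_triang|]. rewrite Rabs_Ropp. lra. }
  assert (Hlb : Rabs l <= Rabs d + (Rabs b * E + Rabs q * F)).
  { replace l with (d + (- (b * E) + - (q * F))) at 1 by (rewrite Hd; ring).
    eapply Rle_trans; [apply Rabs_triang|].
    apply Rplus_le_compat_l.
    eapply Rle_trans; [apply Rabs_triang|].
    rewrite !Rabs_Ropp, !Rabs_mult, (Rabs_right E), (Rabs_right F) by lra. lra. }
  assert (Hkd : k * Rabs d <= A / 2 * Rabs d)
    by (apply Rmult_le_compat_r; [apply Rabs_pos|lra]).
  apply (Rmult_le_compat_l k) in Hlb; [|lra].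
  assert (Hb := Rabs_pos b). assert (Hq := Rabs_pos q).
  set (K := 1 + C + Rabs b + Rabs q).
  assert (Hsum : Rabs b * E + Rabs q * F + (E + C * F) <= K * (E + F)).
  { assert (0 <= (C + Rabs q) * E) by (apply Rmult_le_pos; lra).
    assert (0 <= (1 + Rabs b) * F) by (apply Rmult_le_pos; lra).
    unfold K. lra. }
  apply (Rmult_le_compat_l k) in Hsum; [|lra].
  apply Rmult_le_reg_l with (A / 2); [lra|].
  replace (A / 2 * (2 * k / A * K * (E + F))) with (k * (K * (E + F)))
    by (field; lra).
  lra.
Qed.

(** * The approximation theorem *)

Lemma unit_interval_interval_set : interval_set unit_interval.
Proof. unfold interval_set, unit_interval. intros; lra. Qed.

(** The approximation is read in two ways: formally, as the unique root of the equation with Taylor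
    polynomials inserted, and asymptotically, as a little-o estimate for every true solution. *)
Theorem mainTheorem2
  (I : R -> Prop) (U U' U'' : R -> R) (w0 : R)
  (I_interval : interval_set I)
  (U_C2 : C2_on I U U' U'')
  (U'_pos : forall x, I x -> 0 < U' x)
  (I_w0 : I w0)
  (h h' h'' : R -> R) (p0 : R)
  (h_C2 : C2_on unit_interval h h' h'')
  (h_range : forall p, unit_interval p -> unit_interval (h p))
  (h_0 : h 0 = 0)
  (h_1 : h 1 = 1)
  (h'_pos : forall p, unit_interval p -> 0 < h' p)
  (p0_bounds : 0 < p0 < 1) :
  (forall e1 e2 : R,
     0 < e1 < Rmin p0 (1 - p0) -> 0 < e2 -> I (w0 - e2) -> I (w0 + e2) ->
     let m2 := variance (symmetric_risk e1 e2) in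
     let mbar2 := maxiance (symmetric_risk e1 e2) in
     let Pr := mass (symmetric_risk e1 e2) in
     (m2 = 2 * e1 * e2 ^ 2 /\ mbar2 = 2 * e1 ^ 2 * e2 /\ Pr = 2 * e1) /\
     (forall l : R,
        expanded_premium_equation U U' U'' h h' h'' w0 p0 e1 e2 l <->
        l = rdu_premium_approx U' U'' h' h'' w0 p0 m2 mbar2 Pr)) /\
  (forall eta : R, 0 < eta -> exists delta : R, 0 < delta /\
     forall e1 e2 l : R,
     0 < e1 < Rmin p0 (1 - p0) -> 0 < e2 -> I (w0 - e2) -> I (w0 + e2) ->
     e1 < delta -> e2 < delta ->
     I (w0 - l) -> rdu_premium_equation U h w0 p0 e1 e2 l ->
     let m2 := variance (symmetric_risk e1 e2) in
     let mbar2 := maxiance (symmetric_risk e1 e2) in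
     let Pr := mass (symmetric_risk e1 e2) in
     Rabs (l - rdu_premium_approx U' U'' h' h'' w0 p0 m2 mbar2 Pr)
       <= eta * (m2 / (2 * Pr) + mbar2 / (2 * Pr))).
Proof.
  assert (A_pos := U'_pos w0 I_w0).
  assert (Ip0 : unit_interval p0) by (unfold unit_interval; lra).
  assert (P_pos := h'_pos p0 Ip0).
  split.
  { intros e1 e2 [He1 _] He2 _ _.
    destruct (symmetric_risk_moments e1 e2 He2) as [Hv [Hm HP]].
    simpl. rewrite Hv, Hm, HP.
    split; [now repeat split|].
    intros l. rewrite rdu_premium_approx_symmetric by exact He1.
    now apply expanded_premium_equation_solution. }
  intros eta Heta.
  set (A := U' w0) in *. set (B := U'' w0) in *.
  set (P := h' p0) in *. set (Q := h'' p0) in *.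
  set (b := B / A / 2). set (q := Q / P / 2).
  set (C := 2 * A * (1 + Rabs q) / P).
  assert (Hb := Rabs_pos b). assert (Hq := Rabs_pos q).
  assert (HC : 0 <= C).
  { apply Rlt_le, Rdiv_lt_0_compat; [|exact P_pos].
    repeat apply Rmult_lt_0_compat; lra. }
  set (K := 1 + C + Rabs b + Rabs q).
  assert (HK : 0 < K) by (unfold K; lra).
  (* The bounds 1 and [A / 2] serve the two error estimates; the third makes the final constant at
     most [eta / 2], as the target bound is [eta / 2 * (e2 ^ 2 + e1 * e2)]. *)
  set (k := Rmin (Rmin 1 (A / 2)) (eta * A / (4 * K))).
  assert (Hk : 0 < k).
  { repeat apply Rmin_glb_lt; try lra.
    apply Rdiv_lt_0_compat; [apply Rmult_lt_0_compat|]; lra. }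
  assert (Hk1 : k <= 1)
    by (eapply Rle_trans; [apply Rmin_l|apply Rmin_l]).
  assert (HkA : k <= A / 2)
    by (eapply Rle_trans; [apply Rmin_l|apply Rmin_r]).
  assert (Hketa : 2 * k / A * K <= eta / 2).
  { assert (H : k <= eta * A / (4 * K)) by apply Rmin_r.
    apply (Rmult_le_compat_l (2 / A * K)) in H.
    - replace (2 / A * K * (eta * A / (4 * K))) with (eta / 2) in H
        by (field; lra).
      replace (2 * k / A * K) with (2 / A * K * k) by (field; lra). exact H.
    - apply Rlt_le, Rmult_lt_0_compat; [apply Rdiv_lt_0_compat|]; lra. }
  destruct (D_in_expansion I U U' w0 (proj1 (U_C2 w0 I_w0)) k Hk)
    as [d1 [Hd1 HU1]].
  destruct (taylor2_expansion I U U' U'' w0 I_interval U_C2 I_w0 k Hk)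
    as [d2 [Hd2 HU2]].
  destruct (taylor2_expansion _ h h' h'' p0 unit_interval_interval_set
              h_C2 Ip0 k Hk) as [d3 [Hd3 Hh2]].
  (* [d1] and [d2] constrain [e2] for the expansions of [U]; [d3] constrains [e1] for that of [h]; 1
     and [P / 2] give [e1 <= 1] and [2 * e1 <= P]. *)
  exists (Rmin (Rmin d1 d2) (Rmin d3 (Rmin 1 (P / 2)))).
  split; [repeat apply Rmin_glb_lt; lra|].
  intros e1 e2 l [He1 He1p] He2 Im Ip He1d He2d Il Heq.
  destruct (symmetric_risk_moments e1 e2 He2) as [Hv [Hm HP]].
  simpl. rewrite Hv, Hm, HP. clear Hv Hm HP.
  rewrite rdu_premium_approx_symmetric by exact He1.
  fold A B P Q.
  apply Rmin_Rgt_l in He1p as [He1p He1q].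
  apply Rmin_Rgt_l in He1d as [_ He1d].
  apply Rmin_Rgt_l in He1d as [He1d3 He1d].
  apply Rmin_Rgt_l in He1d as [He1d1 He1dP].
  apply Rmin_Rgt_l in He2d as [He2d _].
  apply Rmin_Rgt_l in He2d as [He2d1 He2d2].
  assert (Ipm : unit_interval (p0 - e1)) by (unfold unit_interval; lra).
  assert (Ipp : unit_interval (p0 + e1)) by (unfold unit_interval; lra).
  assert (h_incr := increasing_on unit_interval h h' unit_interval_interval_set
    (fun x Hx => proj1 (h_C2 x Hx)) h'_pos).
  assert (U_incr := increasing_on I U U' I_interval
    (fun x Hx => proj1 (U_C2 x Hx)) U'_pos).
  assert (Hhm := h_incr _ _ Ipm Ip0 ltac:(lra)).
  assert (Hhp := h_incr _ _ Ip0 Ipp ltac:(lra)).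
  assert (Hl := rdu_premium_le I U h w0 p0 e1 e2 l U_incr (conj Hhm Hhp)
    He2 Im Ip Il Heq).
  apply rdu_indifference_weighted in Heq.
  specialize (HU1 (w0 - l) Il).
  replace (w0 - l - w0) with (- l) in HU1 by ring.
  rewrite Rabs_Ropp in HU1. specialize (HU1 ltac:(lra)).
  assert (HUm := HU2 (w0 - e2) Im). assert (HUp := HU2 (w0 + e2) Ip).
  assert (Hm := Hh2 (p0 - e1) Ipm). assert (Hp := Hh2 (p0 + e1) Ipp).
  replace (w0 - e2 - w0) with (- e2) in HUm by ring.
  replace (w0 + e2 - w0) with e2 in HUp by ring.
  replace (p0 - e1 - p0) with (- e1) in Hm by ring.
  replace (p0 + e1 - p0) with e1 in Hp by ring.
  rewrite Rabs_Ropp, Rabs_right in HUm, Hm by lra.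
  rewrite Rabs_right in HUp, Hp by lra.
  specialize (HUm He2d2). specialize (HUp He2d2).
  specialize (Hm He1d3). specialize (Hp He1d3).
  unfold taylor1, taylor2 in *. fold A B P Q in HU1, HUm, HUp, Hm, Hp.
  assert (Hvl := weighted_increment_bound A B P Q k e1 e2
    (h p0 - h (p0 - e1)) (h (p0 + e1) - h p0)
    (U (w0 - e2) - U w0) (U (w0 + e2) - U w0) (U (w0 - l) - U w0)).
  fold q C in Hvl.
  assert (HB : B / 2 = A * b) by (unfold b; field; lra).
  rewrite HB in Hvl.
  eapply Rle_trans.
  - apply (premium_error_bound A b q k C _ e1 e2 l (U (w0 - l) - U w0));
      try lra.
    + replace (U (w0 - l) - U w0 + A * l)
        with (U (w0 - l) - (U w0 + A * - l)) by ring. exact HU1.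
    + rewrite <- HB in Hvl |- *. apply Hvl; try lra.
      (* The lower decision weight is [h p0] minus the expanded value, so its remainder is that of
         [h] at [p0 - e1] with the opposite sign. *)
      * rewrite Rabs_minus_sym. eapply Rle_trans; [|eapply Rle_trans; [exact Hm|]].
        -- right. f_equal. field.
        -- right. ring.
      * eapply Rle_trans; [|exact Hp]. right. f_equal. field.
      * eapply Rle_trans; [|eapply Rle_trans; [exact HUm|]].
        -- right. f_equal. field.
        -- right. ring.
      * eapply Rle_trans; [|exact HUp]. right. f_equal. field.
    + unfold b, q. field. lra.
  - fold K.
    replace (eta * (2 * e1 * e2 ^ 2 / (2 * (2 * e1)) +
                    2 * e1 ^ 2 * e2 / (2 * (2 * e1))))
      with (eta / 2 * (e2 ^ 2 + e1 * e2)) by (field; lra).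
    apply Rmult_le_compat_r; [|exact Hketa].
    assert (0 <= e2 ^ 2) by apply pow2_ge_0.
    assert (0 < e1 * e2) by (apply Rmult_lt_0_compat; lra).
    lra.
Qed.
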